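(* Let $X$ be a compact metric space, $f\colon X\to\mathbb R$ $L$-Lipschitz, $S\subset X$ compact, $\mu$ a Radon measure on $X$ and $\delta>0$. Assume that $S$ is $\operatorname{Frag}(X,f,\delta)$-null. Then there are $\max(L,\delta)$-Lipschitz functions $g_k\colon X\to\mathbb R$ with $g_k\to f$ weak* such that each $g_k$ is $\mu$-a.e. locally $\delta$-Lipschitz on $S$.
   Context: A fragment in $X$ is a bi-Lipschitz map $\gamma\colon K\to X$ with $K=\operatorname{dom}\gamma\subset\mathbb R$ compact of positive Lebesgue measure. The metric differential is $\operatorname{md}\gamma(t)=\lim_{\operatorname{dom}\gamma\ni t'\to t}d(\gamma(t'),\gamma(t))/|t'-t|$; $(f\circ\gamma)'(t)$ is likewise computed along $\operatorname{dom}\gamma$ (both exist for a.e. $t$). $\operatorname{Frag}(X,f,\delta)$ is the set of fragments $\gamma$ in $X$ with $(f\circ\gamma)'(t)\ge\delta\operatorname{md}\gamma(t)$ for a.e. $t\in\operatorname{dom}\gamma$. For a family $\mathcal G$ of fragments, a Borel set $S$ is $\mathcal G$-null if for each $\gamma\in\mathcal G$ the 1-dimensional Hausdorff measure of $S\cap\gamma(\operatorname{dom}\gamma)$ is zero. Weak* convergence $g_k\to f$ means: $g_k\to f$ pointwise and the global Lipschitz constants of the $g_k$ are uniformly bounded. A function $g$ is $\mu$-a.e. locally $\delta$-Lipschitz on $S$ if for $\mu$-a.e. $x\in S$ there is $r>0$ such that $g|_{B(x,r)}$ is $\delta$-Lipschitz. *)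

(* Defs.v *)
From HB Require Import structures.
From mathcomp Require Import all_boot all_order all_algebra.
From mathcomp Require Import all_classical all_reals all_analysis.

Set Implicit Arguments.
Unset Strict Implicit.
Unset Printing Implicit Defensive.

Import Order.TTheory GRing.Theory Num.Theory.
Import numFieldNormedType.Exports.

Local Open Scope classical_set_scope.
Local Open Scope ring_scope.

(* Measurable types carry a distinguished point, so a metric space bearing a
   Borel measure is taken to be pointed, i.e., nonempty. *)
#[short(type="pmetricType")]
HB.structure Definition PointedMetric (K : numDomainType) :=
  { T of Pointed T & Metric K T }.

Notation borel X := (g_sigma_algebraType (@open X)).

Section lipschitz.
Context {R : realType} {X : metricType R}.

(* The library's k.-lipschitz_A requires normed modules on both sides. *)
Definition lipschitz_in (k : R) (A : set X) (g : X -> R) : Prop :=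
  forall x y, A x -> A y -> `|g x - g y| <= k * mdist x y.

Definition weak_star_cvg (g : nat -> X -> R) (f : X -> R) : Prop :=
  (forall x : X, g k x @[k --> \oo] --> f x) /\
  (exists M : R, forall k, lipschitz_in M [set: X] (g k)).

End lipschitz.

Section hausdorff_measure.
Context {R : realType} {X : metricType R}.
Local Open Scope ereal_scope.

(* The maximum with 0 only serves to give the empty set diameter 0. *)
Definition diam (A : set X) : \bar R :=
  maxe 0 (ereal_sup [set (mdist p.1 p.2)%:E | p in A `*` A]).

Definition hausdorff1_pre (e : R) (A : set X) : \bar R :=
  ereal_inf [set \sum_(0 <= i <oo) diam (E i) | E in
    [set E : nat -> set X |
      (forall i, diam (E i) <= e%:E) /\ A `<=` \bigcup_i E i]].

Definition hausdorff1 (A : set X) : \bar R :=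
  ereal_sup [set hausdorff1_pre e A | e in [set e : R | (0 < e)%R]].

End hausdorff_measure.

Section fragments.
Context {R : realType} (X : metricType R).

(* The values of frag_fun outside frag_dom are irrelevant. *)
Record fragment := Fragment {
  frag_dom : set R ;
  frag_fun :> R -> X ;
  frag_compact : compact frag_dom ;
  frag_pos : (0 < lebesgue_measure frag_dom)%E ;
  frag_bilip : exists c C : R, 0 < c /\
    forall s t, frag_dom s -> frag_dom t ->
      c * `|s - t| <= mdist (frag_fun s) (frag_fun t) <= C * `|s - t| }.

End fragments.

Section frag_families.
Context {R : realType} {X : metricType R}.
Implicit Types (gamma : fragment X) (f : X -> R).

(* In the next two definitions the limit is taken over t' != t in the domain
   of gamma. Both limits exist at almost every t in that domain (when f is
   Lipschitz); elsewhere lim returns an arbitrary value. *)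
Definition md gamma (t : R) : R :=
  lim (mdist (gamma t') (gamma t) / `|t' - t|
         @[t' --> within (frag_dom gamma) t^']).

Definition frag_derive f gamma (t : R) : R :=
  lim ((f (gamma t') - f (gamma t)) / (t' - t)
         @[t' --> within (frag_dom gamma) t^']).

Definition Frag f (delta : R) : set (fragment X) :=
  [set gamma | {ae (@lebesgue_measure R), forall t,
     frag_dom gamma t -> delta * md gamma t <= frag_derive f gamma t}].

Definition null_for (G : set (fragment X)) (S : set X) : Prop :=
  forall gamma, G gamma ->
    hausdorff1 (S `&` (gamma @` frag_dom gamma)) = 0%E.

End frag_families.

Section borel_measures.
Context {R : realType} {X : pmetricType R}.

Definition is_radon (mu : {measure set (borel X) -> \bar R}) : Prop :=
  (forall K : set X, compact K -> (mu K < +oo)%E) /\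
  (forall A : set (borel X), measurable A ->
     mu A = ereal_sup [set mu K | K in
              [set K : set X | compact K /\ K `<=` A]]).

Definition ae_locally_lipschitz_on (mu : {measure set (borel X) -> \bar R})
    (S : set X) (delta : R) (g : X -> R) : Prop :=
  {ae mu, forall x : X, S x ->
     exists2 r : R, 0 < r & lipschitz_in delta (ball x r) g}.

End borel_measures.

(* Main.v *)
Require Import Defs.
From mathcomp Require Import all_boot all_order all_algebra.
From mathcomp Require Import all_classical all_reals all_analysis.
From mathcomp Require Import lra.
Import Order.TTheory GRing.Theory Num.Theory.
Import numFieldNormedType.Exports.
Local Open Scope classical_set_scope.
Local Open Scope ring_scope.

(** Put [K = max L delta]. The approximation [g_k] is the largest function
below [f] whose increments are bounded by a cost which is [delta * d(x, y)]
when [x] and [y] are at distance less than [1/(k+1)] from each other and from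
[S], and [K * d(x, y)] otherwise; concretely, [g_k x] is the infimum, over the
finite chains [x_0, ..., x_n = x], of [f x_0] plus the cost of the chain. Such a
function is [K]-Lipschitz, lies below [f], and is [delta]-Lipschitz on a small
ball around every point of [S] ([chain_inf_lipschitz],
[chain_inf_lipschitz_ball]). What has to be shown is that [g_k] converges to
[f], and the convergence is even uniform ([approx_chain_cvg_uniform]).

Suppose that for arbitrarily large [k] some chain has [f x_n - f x_0] larger
than its cost plus [eps]. Follow [f x_i - f x_0 - cost(x_0, ..., x_i)] along the
chain and keep the points at which it reaches a new maximum. A step that costs
[K d] cannot increase it, so these record points lie close to [S]; between two
records [f] grows by at least the cost of the steps in between, hence by at
least [delta] times the distance; and the values of [f] at the records, thickened
by [K/(k+1)], fill a set of measure at least [eps], because each record adds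
at most [K/(k+1)] to a maximum which ends above [eps] ([chain_records]).

A limit [E] of these record sets as [k] grows, taken along an ultrafilter, is
a compact subset of [S] on which [|f x - f y| >= delta d(x, y)] survives
([expansive_set_lim]), and upper semicontinuity of Lebesgue measure on compact
sets gives [f(E)] positive measure ([lebesgue_measure_set_lim_gt0]). Then the
inverse of [f] on [E] is a fragment [gamma] defined on [f(E)], along which
[(f o gamma)' = 1] and [md gamma <= 1 / delta]; it belongs to [Frag f delta]
([expansive_fragment]); parametrizing by the values of [f] is what makes the
derivative explicit. As [S] is null for this
fragment, [E] has zero length, and so has its Lipschitz image [f(E)]
([lebesgue_measure_image0]): a contradiction. *)

Set Implicit Arguments.
Unset Strict Implicit.

(** * Lipschitz and expansive functions *)

(** For [delta > 0]: [f] is injective on [E], with a [1 / delta]-Lipschitz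
inverse. *)
Definition expansive {R : realType} {X : metricType R} (delta : R) (f : X -> R)
    (E : set X) : Prop :=
  forall x y, E x -> E y -> delta * mdist x y <= `|f x - f y|.

Section lipschitz_functions.
Context {R : realType} {X : metricType R}.
Variables (f : X -> R) (K : R).
Hypotheses (K0 : 0 < K) (f_lip : lipschitz_in K [set: X] f).

Lemma lipschitz_in_continuous : continuous f.
Proof.
move=> x; apply/cvgrPdist_lt => e e0.
near=> y.
rewrite (le_lt_trans (@f_lip x y I I))// -ltr_pdivlMl// mulrC.
near: y.
have : nbhs x (ball x (e / K)) by apply: nbhsx_ballx; rewrite divr_gt0.
by apply: filterS => y; rewrite ballEmdist.
Unshelve. all: by end_near. Qed.

Lemma lipschitz_in_lower_bound :
  compact [set: X] -> exists m, forall x, m <= f x.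
Proof.
move=> cX; have : compact (range f).
  apply: continuous_compact => //; apply: continuous_subspaceT.
  exact: lipschitz_in_continuous.
move=> /compact_bounded[M [_ /(_ (M + 1))]] fM.
exists (- (M + 1)) => x.
have /= : `|f x| <= M + 1 by apply: fM => //; rewrite ltrDl.
by rewrite ler_norml => /andP[].
Qed.

Lemma diam_ge0 (A : set X) : (0 <= diam A)%E.
Proof. by rewrite /diam le_max lexx. Qed.

(** A cover of [E] by sets of diameters [d_i] gives a cover of the image by
intervals of lengths [2 * K * d_i]. *)
Lemma lebesgue_measure_image0 (E : set X) :
  measurable (f @` E) -> hausdorff1 E = 0%E ->
  lebesgue_measure (f @` E) = 0%E.
Proof.
move=> mE HE; apply/eqP; rewrite eq_le measure_ge0 andbT.
apply/lee_addgt0Pr => e e0; rewrite add0e.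
(* The bound 1 on the diameters serves to make them finite. *)
have : (hausdorff1_pre 1 E < (e / (2 * K))%:E)%E.
  apply: (@le_lt_trans _ _ 0%E); last by rewrite lte_fin divr_gt0// mulr_gt0.
  by rewrite -HE; apply: ereal_sup_ubound; exists 1 => //=; rewrite ltr01.
move=> /ereal_inf_lt[_ [C [C1 EC] <-]] Ce.
have dfin i : diam (C i) \is a fin_num.
  rewrite ge0_fin_numE; first by rewrite (le_lt_trans (C1 i))// ltry.
  exact: diam_ge0.
pose d i := fine (diam (C i)).
have dE i : diam (C i) = (d i)%:E by rewrite fineK.
have d0 i : 0 <= d i by rewrite -lee_fin -dE diam_ge0.
have /choice[J J_] i : exists J : set R, [/\ measurable J, f @` C i `<=` J
    & (lebesgue_measure J <= (2 * K)%:E * diam (C i))%E].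
  have [->|/set0P[c Cc]] := eqVneq (C i) set0.
    exists set0; rewrite image_set0 measure0; split=> //.
    by rewrite mule_ge0 ?diam_ge0// lee_fin mulr_ge0// ltW.
  exists `[f c - K * d i, f c + K * d i]%classic; split.
  - exact: measurable_itv.
  - move=> _ [x Cx <-].
    have : `|f x - f c| <= K * d i.
      rewrite (le_trans (@f_lip x c I I))// ler_pM2l// -lee_fin -dE.
      rewrite /diam le_max; apply/orP; right.
      by apply: ereal_sup_ubound; exists (x, c).
    by rewrite /= in_itv/= ler_norml; lra.
  - rewrite lebesgue_measure_itv/= dE; case: ifPn => _.
      by rewrite -EFinB -EFinM lee_fin; lra.
    by rewrite -EFinM lee_fin !mulr_ge0// ltW.
apply: (@le_trans _ _ (\sum_(0 <= i <oo) lebesgue_measure (J i))%E).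
  apply: measure_sigma_subadditive => //.
    by move=> i; have [] := J_ i.
  move=> _ [x Ex <-]; have [i _ Cx] := EC _ Ex; exists i => //.
  by have [_ + _] := J_ i; apply; exists x.
apply: (@le_trans _ _ (\sum_(0 <= i <oo) ((2 * K)%:E * diam (C i)))%E).
  apply: lee_nneseries => [i _ _|i _]; first exact: measure_ge0.
  by have [] := J_ i.
rewrite nneseriesZl; last by move=> i _; rewrite dE lee_fin.
have -> : e%:E = ((2 * K)%:E * (e / (2 * K))%:E)%E.
  by rewrite -EFinM mulrCA divff ?mulr1// gt_eqF// mulr_gt0.
by rewrite lee_pmul2l ?lte_fin ?mulr_gt0// ltW.
Qed.

End lipschitz_functions.

(** * The fragment inverse to an expansive function *)

Lemma ae_limit_point {R : realType} (Q : set R) :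
  {ae @lebesgue_measure R, forall t, Q t -> limit_point Q t}.
Proof.
have cI := @countable_isolated R Q.
exists (isolated Q); split.
- exact: countable_measurable.
- exact: countable_lebesgue_measure0.
- move=> t /= /not_implyP[Qt lt].
  have : closure Q t by exact: subset_closure.
  by rewrite closure_isolated_limit_point => -[].
Qed.

Section inverse_fragment.
Context {R : realType} {X : pmetricType R}.
Variables (f : X -> R) (delta K : R) (E : set X).
Hypotheses (delta0 : 0 < delta) (K0 : 0 < K)
  (f_lip : lipschitz_in K [set: X] f) (Ed : expansive delta f E).

(** Parametrizing [E] by the values of [f] makes the difference quotients of
[f o gamma] constantly equal to 1, and those of [gamma] at most [1 / delta]. At
the limit points of the domain, i.e., almost everywhere on it, this gives the
inequality that defines [Frag], whether or not the metric differential
exists: the default value of a limit is 0. *)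
Lemma expansive_fragment : compact E -> (0 < lebesgue_measure (f @` E))%E ->
  exists2 gamma : fragment X, Frag f delta gamma & gamma @` frag_dom gamma = E.
Proof.
move=> cE fE0.
pose s u := xget point [set x | E x /\ f x = u].
have sP u : (f @` E) u -> E (s u) /\ f (s u) = u.
  by case=> x Ex fx; rewrite /s; case: xgetP => [_ -> //|/(_ x)[]].
have sdist u v : (f @` E) u -> (f @` E) v ->
    delta * mdist (s u) (s v) <= `|u - v|.
  move=> /sP[Eu fu] /sP[Ev fv]; rewrite -{2}fu -{2}fv; exact: Ed.
have cQ : compact (f @` E).
  apply: continuous_compact => //; apply: continuous_subspaceT.
  exact: lipschitz_in_continuous f_lip.
have bl : exists c C : R, 0 < c /\ forall u v, (f @` E) u -> (f @` E) v ->
    c * `|u - v| <= mdist (s u) (s v) <= C * `|u - v|.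
  exists K^-1, delta^-1; rewrite invr_gt0; split=> // u v Qu Qv.
  apply/andP; split; last by rewrite ler_pdivlMl// sdist.
  rewrite ler_pdivrMl//; have [_ {1}<-] := sP _ Qu; have [_ {1}<-] := sP _ Qv.
  exact: f_lip.
exists (Fragment cQ fE0 bl) => /=; last first.
  apply/seteqP; split=> [_ [u Qu <-]|x Ex]; first by case: (sP _ Qu).
  have Qx : (f @` E) (f x) by exists x.
  exists (f x) => //; have [Es fs] := sP _ Qx.
  apply: mdist_positivity; apply/eqP; rewrite eq_le mdist_ge0 andbT.
  by rewrite -(ler_pM2l delta0) mulr0 (le_trans (Ed Es Ex))// fs subrr normr0.
have [N [mN N0 QN]] := ae_limit_point (f @` E).
exists N; split=> // u; apply: contra_notP => Nu Qu.
have lu : limit_point (f @` E) u.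
  by apply: contrapT => lu; apply: Nu; apply: QN => /(_ Qu).
rewrite /md /frag_derive /=.
have PF : ProperFilter (within (f @` E) u^').
  apply: Build_ProperFilter_ex => P uP.
  have [v [vu Qv Pv]] := lu _ uP.
  by exists v; exact: Pv.
have Qu' : \forall t \near within (f @` E) u^', (f @` E) t /\ t != u.
  have := @nbhs_dnbhs_neq R u; apply: filterS => t tu Qt; exact: conj.
have -> : lim ((f (s t) - f (s u)) / (t - u) @[t --> within (f @` E) u^']) = 1.
  apply: cvg_lim => //; apply: cvg_near_cst.
  near=> t.
  have [Qt tu] : (f @` E) t /\ t != u by near: t.
  have [_ ->] := sP _ Qt; have [_ ->] := sP _ Qu.
  by rewrite divff// subr_eq0.
rewrite mulrC -ler_pdivlMr// div1r.
have [cvg|/dvgP ->] := pselect (cvg (mdist (s t) (s u) / `|t - u|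
         @[t --> within (f @` E) u^'])); last by rewrite invr_ge0 ltW.
apply: limr_le => //.
near=> t.
have [Qt tu] : (f @` E) t /\ t != u by near: t.
rewrite ler_pdivrMr ?normr_gt0 ?subr_eq0// ler_pdivlMl//.
exact: sdist.
Unshelve. all: by end_near. Qed.

End inverse_fragment.

(** * Limits of sets along an ultrafilter *)

Definition thickening {R : realType} {X : metricType R} (S : set X) (r : R) :
    set X := [set x | exists2 s, S s & mdist x s < r].

Definition set_lim {R : realType} {X : metricType R} (F : set_system nat)
    (E : nat -> set X) : set X :=
  [set x | forall r, 0 < r -> \forall n \near F, thickening (E n) r x].

Section set_lim.
Context {R : realType} {X : metricType R}.
Variables (F : set_system nat) (UF : UltraFilter F).
Variables (E : nat -> set X).

Lemma closed_set_lim : closed (set_lim F E).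
Proof.
move=> x clx r r0.
have r2 : 0 < r / 2 by rewrite divr_gt0.
have [y [Ey]] := clx _ (nbhsx_ballx x _ r2).
rewrite ballEmdist/= => xy.
apply: filterS (Ey _ r2) => n [z Ez yz]; exists z => //.
by rewrite (le_lt_trans (metric_triangle x y z))// (splitr r) ltrD.
Qed.

(** Compactness only gives a cluster point; along an ultrafilter it is a
limit, because a set that meets every member of the ultrafilter belongs to it. *)
Lemma set_lim_seq (u : nat -> X) : compact [set: X] ->
  (\forall n \near F, E n (u n)) ->
  exists2 x, set_lim F E x &
    forall r, 0 < r -> \forall n \near F, mdist x (u n) < r.
Proof.
move=> cX Eu.
have PF : ProperFilter (u @ F) by exact: fmap_proper_filter.
have [x [_ ux]] := cX (u @ F) PF filterT.
have near_ux r : 0 < r -> \forall n \near F, mdist x (u n) < r.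
  move=> r0.
  have [//|Fr] := in_ultra_setVsetC [set n | mdist x (u n) < r] UF.
  have Fr' : F (u @^-1` (~` ball x r)).
    by apply: (filterS _ Fr) => n; rewrite /= ballEmdist.
  by have [y []] := ux _ _ Fr' (nbhsx_ballx x _ r0).
exists x => // r r0.
by near=> n; exists (u n); near: n => //; exact: near_ux.
Unshelve. all: by end_near. Qed.

(** Two points of the limit are approximated by points of one and the same
[E n], as two members of a filter meet. *)
Lemma expansive_set_lim (delta : R) (f : X -> R) : 0 < delta -> continuous f ->
  (\forall n \near F, expansive delta f (E n)) ->
  expansive delta f (set_lim F E).
Proof.
move=> delta0 cf Ed x y Ex Ey.
apply/ler_addgt0Pr => e e0.
(* The error is the sum of four terms: two distances and two values of f. *)
pose e' := e / 4.
have e'0 : 0 < e' by rewrite divr_gt0.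
have d0 : 0 < e' / delta by rewrite divr_gt0.
have near_E z : set_lim F E z -> \forall n \near F,
    exists2 a, E n a & `|f z - f a| < e' /\ delta * mdist z a < e'.
  have /cvgrPdist_lt/(_ _ e'0)/nbhs_ballP[r /= r0 zr] := cf z.
  have m0 : 0 < Num.min r (e' / delta) by rewrite lt_min r0.
  move=> /(_ _ m0); apply: filterS => n [a Ea]; rewrite lt_min => /andP[za za'].
  exists a => //; split; first by apply: zr; rewrite ballEmdist.
  by rewrite mulrC -ltr_pdivlMr.
have [n [[[a Ea [fxa xa]] [b Eb [fyb yb]]] En]] :=
  filter_ex (filterI (filterI (near_E _ Ex) (near_E _ Ey)) Ed).
have tr : delta * mdist x y <=
    delta * mdist x a + delta * mdist a b + delta * mdist y b.
  rewrite -!mulrDr ler_pM2l// (le_trans (metric_triangle x b y))//.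
  by rewrite (metric_sym b y) lerD2r metric_triangle.
have := En a b Ea Eb.
have -> : f a - f b = (f x - f y) - (f x - f a) + (f y - f b) by lra.
have := ler_normD (f x - f y - (f x - f a)) (f y - f b).
have := ler_normB (f x - f y) (f x - f a).
rewrite /e' in fxa fyb xa yb *; lra.
Qed.

(** An open set [V] containing the image of the limit contains [B n] for some
[n]: otherwise the points [u n] of [E n] near some [b n] outside [V] would tend
to a point of the limit with value outside [V]. So every such [V] has measure at
least [eps], and outer regularity concludes. *)
Lemma lebesgue_measure_set_lim_gt0 (f : X -> R) (eps : R)
    (B : nat -> set R) (r : nat -> R) :
  0 < eps -> compact [set: X] -> continuous f ->
  r @ F --> 0 ->
  (forall n, measurable (B n) /\ (eps%:E <= lebesgue_measure (B n))%E) ->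
  (forall n b, B n b -> exists2 a, E n a & `|f a - b| <= r n) ->
  (0 < lebesgue_measure (f @` set_lim F E))%E.
Proof.
move=> eps0 cX cf r0 mB BE.
set Q := f @` set_lim F E.
have cQ : compact Q.
  apply: continuous_compact; first exact: continuous_subspaceT.
  by apply: (subclosed_compact _ cX) => //; exact: closed_set_lim.
have mQ : measurable Q by exact: measurable_realfun.compact_measurable.
rewrite ltNge; apply/negP => Qle0.
have Q0 : lebesgue_measure Q = 0%E by apply/eqP; rewrite eq_le Qle0 measure_ge0.
have Qoo : (lebesgue_measure Q < +oo)%E by rewrite Q0 ltry.
have [V [oV QV VQ]] := lebesgue_regularity_outer mQ Qoo eps0.
have mV : measurable V by exact: measurable_realfun.open_measurable.
have Ve : (lebesgue_measure V < eps%:E)%E.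
  have : (lebesgue_measure (Q `|` (V `\` Q)) <=
      lebesgue_measure Q + lebesgue_measure (V `\` Q))%E.
    by apply: measureU2 => //; exact: measurableD.
  by rewrite setDUK// Q0 add0e => /le_lt_trans; apply.
have /choice[b Bb] n : exists b, B n b /\ ~ V b.
  apply: contrapT => nb; have [mBn] := mB n; apply/negP; rewrite -ltNge.
  apply: le_lt_trans Ve; apply: le_measure; rewrite ?inE//.
  by move=> b Bb; apply: contrapT => Vb; apply: nb; exists b.
have /choice[u Eu] n : exists a, E n a /\ `|f a - b n| <= r n.
  by have [a Ea ab] := BE _ _ (Bb n).1; exists a.
have [|x Ex ux] := set_lim_seq (u := u) cX.
  by apply: nearW => n; exact: (Eu n).1.
have Vx : V (f x) by apply: QV; exists x.
have /nbhs_ballP[e /= e0 fV] := open_nbhs_nbhs (conj oV Vx).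
have e2 : 0 < e / 2 by rewrite divr_gt0.
have /cvgrPdist_lt/(_ _ e2)/nbhs_ballP[d /= d0 fd] := cf x.
move/cvgrPdist_lt : r0 => /(_ _ e2) r0.
have [n [/= xn]] := filter_ex (filterI (ux _ d0) r0).
rewrite sub0r normrN => rn.
apply: (Bb n).2; apply: fV; rewrite /ball/=.
have := fd (u n); rewrite ballEmdist => /(_ xn) fxu.
have -> : f x - b n = (f x - f (u n)) + (f (u n) - b n) by lra.
rewrite (le_lt_trans (ler_normD _ _))// (splitr e) ltrD//.
by rewrite (le_lt_trans (Eu n).2)// (le_lt_trans (ler_norm _)).
Qed.

End set_lim.

(** * Infima over chains *)

Section chains.
Context {R : realType} {X : metricType R}.
Variables (f : X -> R) (delta K r : R) (U : set X).

Definition step_cost (x y : X) : R :=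
  (if `[< [/\ U x, U y & mdist x y < r] >] then delta else K) * mdist x y.

Inductive chain_value : X -> R -> Prop :=
| chain_start x : chain_value x (f x)
| chain_step x v y : chain_value x v -> chain_value y (v + step_cost x y).

Definition chain_inf (x : X) : R := inf (chain_value x).

Hypotheses (delta_gt0 : 0 < delta) (delta_le : delta <= K).

Lemma step_cost_le x y : step_cost x y <= K * mdist x y.
Proof. by rewrite ler_wpM2r ?mdist_ge0//; case: ifP. Qed.

Lemma step_cost_ge x y : delta * mdist x y <= step_cost x y.
Proof. by rewrite ler_wpM2r ?mdist_ge0//; case: ifP. Qed.

Lemma step_cost_ge0 x y : 0 <= step_cost x y.
Proof.
by apply: le_trans (step_cost_ge x y); rewrite mulr_ge0 ?mdist_ge0// ltW.
Qed.

Lemma step_cost_sym x y : step_cost x y = step_cost y x.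
Proof.
rewrite /step_cost metric_sym; congr (_ * _); congr (if _ then _ else _).
by apply: asbool_equiv_eq; split=> -[].
Qed.

Section infimum.
Variable m : R.
Hypothesis f_ge : forall x, m <= f x.

Lemma chain_value_ge x v : chain_value x v -> m <= v.
Proof.
elim=> {x v} [x|x v y _ mv]; first exact: f_ge.
by rewrite (le_trans mv)// lerDl step_cost_ge0.
Qed.

Lemma has_inf_chain_value x : has_inf (chain_value x).
Proof.
split; first by exists (f x); exact: chain_start.
by exists m => v /chain_value_ge.
Qed.

Lemma chain_inf_le x : chain_inf x <= f x.
Proof.
by apply: ge_inf; [exact: (has_inf_chain_value x).2|exact: chain_start].
Qed.

Lemma chain_inf_step x y : chain_inf y - chain_inf x <= step_cost x y.
Proof.
rewrite lerBlDr -lerBlDl; apply: lb_le_inf.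
  exact: (has_inf_chain_value x).1.
move=> v xv; rewrite lerBlDr; apply: ge_inf.
  exact: (has_inf_chain_value y).2.
exact: chain_step.
Qed.

Lemma chain_inf_dist x y : `|chain_inf x - chain_inf y| <= step_cost x y.
Proof.
have := chain_inf_step x y; have := chain_inf_step y x.
by rewrite (step_cost_sym y) ler_norml; lra.
Qed.

Lemma chain_inf_lipschitz : lipschitz_in K [set: X] chain_inf.
Proof.
by move=> x y _ _; rewrite (le_trans (chain_inf_dist x y))// step_cost_le.
Qed.

Lemma chain_inf_lipschitz_ball x : ball x (r / 2) `<=` U ->
  lipschitz_in delta (ball x (r / 2)) chain_inf.
Proof.
move=> xU y z xy xz; rewrite (le_trans (chain_inf_dist y z))//.
rewrite /step_cost ifT//; apply/asboolP; split; [exact: xU|exact: xU|].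
move: xy xz; rewrite ballEmdist/= => xy xz.
rewrite (le_lt_trans (metric_triangle y x z))// (splitr r).
by rewrite (metric_sym y) ltrD.
Qed.

End infimum.

(** For a chain [x_0, ..., x_n = y] of value [v], let [v_i] be [f x_0] plus the
cost of its first [i] steps, so that [v_n = v]. The witnesses are as follows:
[M] is the maximum of the [f x_i - v_i]; [z] is the last point at which a new
maximum is reached, so that its [v_i] is [f z - M]; [E] consists of the record
points [x_i] with [i > 0]. A new record [y] with maximum [w] adds to [B] the
half-open interval from [f y - (w - M)] to [f y]. It is disjoint from [B]
because [f z <= f y - (w - M)], and its length [w - M] is at most the increment
of [f] over the last step, hence at most [K * r]. *)
Lemma chain_records y v : lipschitz_in K [set: X] f -> chain_value y v ->
  exists (z : X) (E : set X) (B : set R) (M : R),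
  [/\ f y - v <= M, delta * mdist z y <= v - (f z - M),
      E `<=` U /\ expansive delta f E,
      forall a, E a -> delta * mdist a z <= f z - f a &
      [/\ measurable B, lebesgue_measure B = M%:E,
          forall b, B b -> b <= f z &
          forall b, B b -> exists2 a, E a & `|f a - b| <= K * r]].
Proof.
move=> f_lip.
elim=> {y v} [x|x v y _ [z [E [B [M [fxM zx [EU Ed] Ez [mB BM Bz Br]]]]]]].
  exists x, set0, set0, 0; rewrite subrr subr0 subrr mdistxx mulr0.
  by split=> //; split=> //; rewrite measure0.
have dz : delta * mdist z y <= delta * mdist z x + step_cost x y.
  apply: le_trans (lerD (lexx _) (step_cost_ge x y)).
  by rewrite -mulrDr ler_pM2l// metric_triangle.
have c0 := step_cost_ge0 x y.
have [fyM|Mfy] := leP (f y - (v + step_cost x y)) M.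
  by exists z, E, B, M; split=> //; lra.
have dd0 : 0 <= delta * mdist z x by rewrite mulr_ge0 ?mdist_ge0// ltW.
have fxy : step_cost x y < f y - f x by lra.
have fxyK : f y - f x <= K * mdist x y.
  by rewrite metric_sym (le_trans (ler_norm _))// f_lip.
(* A step of cost K * d does not increase the maximum. *)
have [Uy xyr] : U y /\ mdist x y < r.
  move: fxy; rewrite /step_cost; case: asboolP => [[]//|_].
  by rewrite ltNge fxyK.
have K0 : 0 < K by exact: lt_le_trans delta_le.
have Kr : K * mdist x y <= K * r by rewrite ler_pM2l// ltW.
set w := f y - (v + step_cost x y) in Mfy *.
have wE : f y = w + v + step_cost x y by rewrite /w; lra.
have zy : delta * mdist z y <= f y - f z by lra.
have Ey a : E a -> delta * mdist a y <= f y - f a.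
  move=> /Ez az; apply: (@le_trans _ _ (delta * mdist a z + delta * mdist z y)).
    by rewrite -mulrDr ler_pM2l// metric_triangle.
  by lra.
exists y, (y |` E), (B `|` `]v + step_cost x y + M, f y]%classic), w.
split=> //.
- by rewrite mdistxx mulr0; lra.
- split; first by move=> a [->|/EU].
  move=> a b [->|Ea] [->|Eb].
  + by rewrite mdistxx mulr0.
  + by rewrite metric_sym (le_trans (Ey _ Eb))// ler_norm.
  + by rewrite distrC (le_trans (Ey _ Ea))// ler_norm.
  + exact: Ed.
- by move=> a [->|/Ey//]; rewrite mdistxx mulr0 subrr.
- split.
  + by apply: measurableU => //; exact: measurable_itv.
  + set I := `]v + step_cost x y + M, f y]%classic.
    have BI : B `&` I = set0.
      rewrite -subset0 => b [/Bz bz]; rewrite /I /= in_itv/= => /andP[yb _].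
      by lra.
    have -> : lebesgue_measure (B `|` I) =
        (lebesgue_measure B + lebesgue_measure I)%E.
      by apply: measureU => //; exact: measurable_itv.
    rewrite BM lebesgue_measure_itv/= lte_fin ifT; last by lra.
    by rewrite -EFinB -EFinD; congr EFin; lra.
  + move=> b [/Bz|]; first by lra.
    by rewrite /= in_itv/= => /andP[].
  + move=> b [/Br[a Ea ab]|]; first by exists a => //; right.
    rewrite /= in_itv/= => /andP[yb byy]; exists y; first by left.
    by rewrite ger0_norm; lra.
Qed.

End chains.

(** * Uniform convergence *)

Section convergence.
Context {R : realType} {X : pmetricType R}.
Variables (f : X -> R) (delta K : R) (S : set X).

Definition approx_chain (k : nat) : X -> R :=
  chain_inf f delta K (harmonic k) (thickening S (harmonic k)).

Hypotheses (delta_gt0 : 0 < delta) (delta_le : delta <= K)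
  (f_lip : lipschitz_in K [set: X] f)
  (cX : compact [set: X]) (cS : compact S).

Let K0 : 0 < K. Proof. exact: lt_le_trans delta_le. Qed.

(** The record sets of bad chains at finer and finer scales converge to a
subset of [S] that carries a fragment of [Frag f delta] of positive length. *)
Lemma approx_chain_cvg_uniform : null_for (Frag f delta) S ->
  forall eps, 0 < eps ->
  \forall k \near \oo, forall x, f x - approx_chain k x <= eps.
Proof.
move=> nullS eps eps0; apply: contrapT => Nconv.
have [m fm] := lipschitz_in_lower_bound K0 f_lip cX.
have bad n : exists EB : set X * set R,
    [/\ EB.1 `<=` thickening S (harmonic n), expansive delta f EB.1,
        measurable EB.2 /\ (eps%:E <= lebesgue_measure EB.2)%E &
        forall b, EB.2 b -> exists2 a, EB.1 a & `|f a - b| <= K * harmonic n].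
  have [k [nk [x fx]]] : exists k, (n <= k)%N /\
      exists x, eps < f x - approx_chain k x.
    apply: contrapT => Nk; apply: Nconv; exists n => // k nk x.
    rewrite leNgt; apply/negP => fx; apply: Nk.
    by exists k; split=> //; exists x.
  have hkn : harmonic k <= harmonic n :> R.
    by rewrite /harmonic lef_pV2 ?posrE// ler_nat ltnS.
  have e'0 : 0 < f x - approx_chain k x - eps by rewrite subr_gt0.
  have [v xv vlt] := inf_adherent e'0
    (has_inf_chain_value (harmonic k) (thickening S (harmonic k))
      delta_gt0 delta_le fm x).
  have {}vlt : v < f x - eps by move: vlt; rewrite -/(approx_chain k x); lra.
  have [z [E [B [M [fvM _ [EU Ed] _ [mB BM _ Br]]]]]] :=
    chain_records delta_gt0 delta_le f_lip xv.
  exists (E, B); split=> //=.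
  - move=> a /EU[s Ss sa]; exists s => //; exact: lt_le_trans hkn.
  - by split=> //; rewrite BM lee_fin; lra.
  - move=> b /Br[a Ea ab]; exists a => //.
    by rewrite (le_trans ab)// ler_pM2l.
have {bad} [EB bad] := choice bad.
have [F [UF Foo]] := ultraFilterLemma (F := \oo : set_system nat) _.
pose E n := (EB n).1; pose B n := (EB n).2.
have cf := lipschitz_in_continuous K0 f_lip.
have h0 : (@harmonic R) @ F --> 0.
  by apply: cvg_trans cvg_harmonic; exact: cvg_app.
have Egt0 : (0 < lebesgue_measure (f @` set_lim F E))%E.
  apply: (lebesgue_measure_set_lim_gt0 UF (B := B)
    (r := fun n => K * harmonic n) eps0 cX cf).
  - by rewrite -(mulr0 K); exact: cvgMr.
  - by move=> n; have [] := bad n.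
  - by move=> n; have [] := bad n.
have Ed : expansive delta f (set_lim F E).
  apply: expansive_set_lim => //.
  by apply: nearW => n; have [] := bad n.
have ES : set_lim F E `<=` S.
  move=> x Ex; apply: (compact_closed (@metric_hausdorff R X) cS).
  move=> A /nbhs_ballP[r /= r0 rA].
  have r2 : 0 < r / 2 by rewrite divr_gt0.
  have /cvgrPdist_lt/(_ _ r2) hr := h0.
  have [n [[y Ey xy]]] := filter_ex (filterI (Ex _ r2) hr).
  have [/(_ _ Ey)[s Ss ys] _ _ _] := bad n.
  rewrite sub0r normrN ger0_norm ?harmonic_ge0// => hn.
  exists s; split => //; apply: rA; rewrite ballEmdist/=.
  rewrite (le_lt_trans (metric_triangle x y s))// (splitr r) ltrD//.
  exact: lt_trans hn.
have cE : compact (set_lim F E).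
  by apply: (subclosed_compact _ cX) => //; exact: closed_set_lim.
have [gamma Fgamma gammaE] :=
  expansive_fragment delta_gt0 K0 f_lip Ed cE Egt0.
have := nullS _ Fgamma; rewrite gammaE.
have -> : S `&` set_lim F E = set_lim F E by apply/setIidPr.
move=> /(lebesgue_measure_image0 K0 f_lip) fE0.
move: Egt0; rewrite fE0 ?ltxx//.
apply: measurable_realfun.compact_measurable; apply: continuous_compact => //.
exact: continuous_subspaceT.
Qed.

End convergence.

Unset Implicit Arguments.
Set Strict Implicit.

Theorem theorem1p21 (R : realType) (X : pmetricType R) (L delta : R)
    (f : X -> R) (S : set X) (mu : {measure set (borel X) -> \bar R})
    (hX : compact [set: X])
    (hf : lipschitz_in L [set: X] f)
    (hS : compact S)
    (hmu : is_radon mu)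
    (hdelta : 0 < delta)
    (hnull : null_for (Frag f delta) S) :
  exists g : nat -> X -> R,
    [/\ forall k, lipschitz_in (Num.max L delta) [set: X] (g k),
        weak_star_cvg g f
      & forall k, ae_locally_lipschitz_on mu S delta (g k)].
Proof.
pose K := Num.max L delta.
have dK : delta <= K by rewrite le_max lexx orbT.
have K0 : 0 < K by exact: lt_le_trans dK.
have fK : lipschitz_in K [set: X] f.
  move=> x y _ _; rewrite (le_trans (hf x y I I))// ler_wpM2r ?mdist_ge0//.
  by rewrite le_max lexx.
have [m fm] := lipschitz_in_lower_bound K0 fK hX.
have gK k : lipschitz_in K [set: X] (approx_chain f delta K S k).
  exact: (chain_inf_lipschitz _ _ hdelta dK fm).
exists (approx_chain f delta K S); split=> //.
  split; last by exists K.
  move=> x; apply/cvgrPdist_le => eps eps0.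
  have := approx_chain_cvg_uniform hdelta dK fK hX hS hnull eps0.
  apply: filterS => k gk; rewrite ger0_norm ?gk// subr_ge0.
  exact: (chain_inf_le _ _ hdelta dK fm).
move=> k; apply: aeW => x Sx.
have h0 := @harmonic_gt0 R k.
exists (harmonic k / 2); first by rewrite divr_gt0.
apply: (chain_inf_lipschitz_ball hdelta dK fm).
move=> y; rewrite ballEmdist/= => xy; exists x => //.
by rewrite metric_sym (lt_trans xy)// ltr_pdivrMr// ltr_pMr// ltr1n.
Qed.
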